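(* For all integers $m \ge 2$ and $n \ge 2$, $\chi_{la}(P_n \circ \overline{K_m}) = mn+2$, where $P_n$ is the path on $n$ vertices.
   Context: Let $G=(V,E)$ be a finite simple undirected graph with no component isomorphic to $K_2$. A bijection $f : E \to \{1,2,\dots,|E|\}$ is a local antimagic labeling of $G$ if $w(u)\ne w(v)$ for every pair of adjacent vertices $u,v$, where $w(u)=\sum_{e\in E(u)} f(e)$ and $E(u)$ is the set of edges incident to $u$. Such an $f$ induces the proper vertex coloring $v\mapsto w(v)$, which uses $|\{w(v): v\in V\}|$ colors. The local antimagic chromatic number $\chi_{la}(G)$ is the minimum number of colors used over all colorings induced by local antimagic labelings of $G$ (so $\chi_{la}(G)\le k$ means that there is a local antimagic labeling inducing at most $k$ colors). The corona product $G\circ H$ is obtained from one copy of $G$ and $|V(G)|$ copies of $H$ by joining the $i$-th vertex of $G$ to every vertex of the $i$-th copy of $H$, for $1\le i\le |V(G)|$. $\overline{K_m}$ is the null (edgeless) graph on $m$ vertices. *)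

(* Defs.v *)
From mathcomp Require Import all_boot.
Set Implicit Arguments.
Unset Strict Implicit.
Unset Printing Implicit Defensive.

Record sgraph := SGraph {
  vertex :> finType;
  adj : rel vertex;
  adj_sym : symmetric adj;
  adj_irrefl : irreflexive adj }.

Definition edges (G : sgraph) : {set {set G}} :=
  [set [set p.1; p.2] | p : G * G & adj p.1 p.2].

Definition weight (G : sgraph) (f : {set G} -> nat) (u : G) : nat :=
  \sum_(e in edges G | u \in e) f e.

(* [f] is total on vertex sets, but only its restriction to [edges G] matters:
   the first two clauses make that restriction a bijection onto
   {1, ..., #|edges G|}. *)
Definition local_antimagic (G : sgraph) (f : {set G} -> nat) : Prop :=
  [/\ {in edges G &, injective f},
      forall k, 1 <= k <= #|edges G| <-> exists2 e, e \in edges G & f e = k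
    & forall u v : G, adj u v -> weight f u <> weight f v].

Definition num_colors (G : sgraph) (f : {set G} -> nat) : nat :=
  size (undup [seq weight f v | v : G]).

(* The chromatic number is given as a relation because the minimum exists only
   when [G] has a local antimagic labeling, which fails if some component of
   [G] is a K_2. *)
Definition is_chi_la (G : sgraph) (k : nat) : Prop :=
  (exists2 f : {set G} -> nat, local_antimagic f & num_colors f = k) /\
  (forall f : {set G} -> nat, local_antimagic f -> k <= num_colors f).

Lemma is_chi_la_unique (G : sgraph) (k l : nat) :
  is_chi_la G k -> is_chi_la G l -> k = l.
Proof.
move=> [[f lf <-] minf] [[g lg <-] ming].
by apply/eqP; rewrite eqn_leq minf // ming.
Qed.

Definition path_rel (n : nat) : rel 'I_n :=
  fun i j => (i.+1 == j :> nat) || (j.+1 == i :> nat).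

Lemma path_rel_sym n : symmetric (@path_rel n).
Proof. by move=> i j; rewrite /path_rel orbC. Qed.

Lemma path_rel_irrefl n : irreflexive (@path_rel n).
Proof. by move=> i; rewrite /path_rel orbb gtn_eqF. Qed.

Definition path_graph (n : nat) : sgraph :=
  SGraph (@path_rel_sym n) (@path_rel_irrefl n).

Definition null_rel (m : nat) : rel 'I_m := fun _ _ => false.

Lemma null_rel_sym m : symmetric (@null_rel m).
Proof. by []. Qed.

Lemma null_rel_irrefl m : irreflexive (@null_rel m).
Proof. by []. Qed.

Definition null_graph (m : nat) : sgraph :=
  SGraph (@null_rel_sym m) (@null_rel_irrefl m).

(* [inl u] is the vertex [u] of [G]; [inr (u, x)] is the vertex [x] of the copy
   of [H] attached to [u]. *)
Definition corona_rel (G H : sgraph) : rel (G + G * H)%type :=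
  fun a b => match a, b with
  | inl u, inl v => adj u v
  | inl u, inr p => u == p.1
  | inr p, inl u => u == p.1
  | inr p, inr q => (p.1 == q.1) && adj p.2 q.2
  end.

Lemma corona_rel_sym G H : symmetric (@corona_rel G H).
Proof.
move=> [u|p] [v|q] //=; first exact: adj_sym.
by rewrite eq_sym adj_sym.
Qed.

Lemma corona_rel_irrefl G H : irreflexive (@corona_rel G H).
Proof. by move=> [u|p] /=; rewrite adj_irrefl ?andbF. Qed.

Definition corona (G H : sgraph) : sgraph :=
  SGraph (@corona_rel_sym G H) (@corona_rel_irrefl G H).

(* Main.v *)
Require Import Defs.
From mathcomp Require Import all_boot.
From mathcomp Require Import zify.

(* Write q = mn + n - 1 for the number of edges.

   Lower bound: the mn leaves have distinct weights at most q, so it suffices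
   to find two adjacent spine vertices of weight larger than q.  Otherwise the
   set B of spine vertices of weight at most q meets every spine edge, so the
   m|B| + n - 1 edges meeting B have distinct positive labels of sum at most
   |B|q, which is impossible.

   Upper bound: it suffices to find a labeling whose spine weights take two
   values according to the parity of the vertex.  Giving two more leaves, with
   the new labels q + 1 + i and q + 2n - i, to the i-th spine vertex adds the
   same amount to every spine weight, so only m = 2 and m = 3 are needed.
   There, labels with alternating or consecutive sums at consecutive edges are
   put on the spine, and an explicit partition of 2n consecutive labels into
   pairs corrects the weights. *)

Set Implicit Arguments.
Unset Strict Implicit.
Unset Printing Implicit Defensive.

(** * Labelings of the caterpillar with two spine weights *)

Ltac lia_if :=
  intros; repeat match goal with
    H : context[if _ then _ else _] |- _ => revert H end;
  repeat case: ifP; lia.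

(* The spine has vertices 0, .., n - 1; [e i] is the label of the edge between
   i - 1 and i, and [p i x] that of the x-th leaf edge at i. *)
Record labeling (n m : nat) (e : nat -> nat) (p : nat -> nat -> nat) : Prop := {
  spine_range : forall i, 0 < i < n -> 0 < e i <= n * m + n.-1;
  leaf_range : forall i x, i < n -> x < m -> 0 < p i x <= n * m + n.-1;
  spine_inj : forall i j, 0 < i < n -> 0 < j < n -> e i = e j -> i = j;
  leaf_inj : forall i x j y, i < n -> x < m -> j < n -> y < m ->
    p i x = p j y -> i = j /\ x = y;
  spine_leaf_neq : forall i j x, 0 < i < n -> j < n -> x < m -> e i <> p j x }.

(** A partition of 0, .., 2n - 1 into [n] pairs; that every value occurs follows by counting. *)
Record pairing (n : nat) (a b : nat -> nat) : Prop := {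
  pairing_l : forall i, i < n -> a i < 2 * n;
  pairing_r : forall i, i < n -> b i < 2 * n;
  pairing_injl : forall i j, i < n -> j < n -> a i = a j -> i = j;
  pairing_injr : forall i j, i < n -> j < n -> b i = b j -> i = j;
  pairing_neq : forall i j, i < n -> j < n -> a i <> b j }.

(** The offset [n * m + n] is one more than the largest old label, so the [2 * n] new labels follow
    the old ones without a gap. *)
Definition add_pair n m (p : nat -> nat -> nat) (a b : nat -> nat) i x :=
  if x < m then p i x else n * m + n + (if x == m then a i else b i).

Lemma add_pair_labeling n m e p a b :
  labeling n m e p -> pairing n a b -> labeling n m.+2 e (add_pair n m p a b).
Proof.
move=> [eR pR eI pI dep] [aR bR aI bI dab]; rewrite /add_pair.
split=> //.
- by move=> i /eR; rewrite !mulnS; lia.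
- move=> i x ltin ltx; rewrite !mulnS; case: ifP => [/(pR _ _ ltin)|].
    by lia.
  by have := aR _ ltin; have := bR _ ltin; case: ifP; lia.
- move=> i x j y ltin ltx ltjn lty.
  case: (ltnP x m) => xm; case: (ltnP y m) => ym.
  + exact: pI.
  + by have := pR _ _ ltin xm; lia.
  + by have := pR _ _ ltjn ym; lia.
  + case: eqP => xE; case: eqP => yE /addnI.
    * by move/(aI _ _ ltin ltjn); lia.
    * by move/(dab _ _ ltin ltjn).
    * by move/esym/(dab _ _ ltjn ltin).
    * by move/(bI _ _ ltin ltjn); lia.
- move=> i j x hi ltjn ltx; case: (ltnP x m) => xm; first exact: dep.
  by have := eR _ hi; lia.
Qed.

Lemma sum_add_pair n m p a b i :
  \sum_(x < m.+2) add_pair n m p a b i x =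
  \sum_(x < m) p i x + 2 * (n * m + n) + a i + b i.
Proof.
rewrite !big_ord_recr /= /add_pair eqxx ltnn.
rewrite (eq_bigr (fun x : 'I_m => p i x)) => [|x _]; last by rewrite ltn_ord.
have -> : (m.+1 < m) = false by lia.
have -> : (m.+1 == m) = false by lia.
by move: (bigop _ _ _) => s; lia.
Qed.

(* [e 0] and [e n] belong to no edge; they are set to 0 so that the weights of
   the two end vertices need no separate formula. *)
Definition has_two_valued_labeling n m :=
  exists e p (w : bool -> nat), [/\ labeling n m e p, e 0 = 0 /\ e n = 0,
    w true <> w false &
    forall i, i < n -> e i + e i.+1 + \sum_(x < m) p i x = w (odd i)].

Lemma has_two_valued_labelingSS n m :
  has_two_valued_labeling n m -> has_two_valued_labeling n m.+2.
Proof.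
move=> [e [p [w [lab e0n wtf wE]]]].
pose a i : nat := i; pose b i := 2 * n - 1 - i.
exists e, (add_pair n m p a b), (fun b => w b + (2 * (n * m + n) + 2 * n - 1)).
split=> //.
- by apply: add_pair_labeling => //; rewrite /a /b; split; lia.
- by lia.
- by move=> i ltin; rewrite sum_add_pair -wE // /a /b; lia.
Qed.

(* The vertices before n - 1 get pairs with one of two sums, according to their
   parity; the sum 2 n - 1 of the pair at n - 1 makes up for the virtual edge
   label [e n = 0] there. *)
Definition low_pair n i :=
  let l := n.-1./2 in let t := n.-1 - i in
  if t == 0 then n - 1 else if odd t then l + t./2 else t./2 - 1.

Definition high_pair n i :=
  let l := n.-1./2 in let t := n.-1 - i in
  if t == 0 then n else if odd t then 2 * n - 1 - t./2
  else n + l - (t./2 - 1).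

(** For even [t > 0] the low values fill 0, .., [l - 1], for odd [t] they fill [l], .., [n - 2], and
    [t = 0] takes [n - 1]. The high values fill [n], .., [2 * n - 1] in the same manner. *)
Lemma low_high_pairing n : 0 < n -> pairing n (low_pair n) (high_pair n).
Proof. by move=> n_gt0; rewrite /low_pair /high_pair; split; lia_if. Qed.

Lemma low_high_sum n i : i < n -> low_pair n i + high_pair n i =
  if i == n.-1 then 2 * n - 1
  else if odd i == odd n.-1 then n + n.-1./2 else 2 * n - 1 + n.-1./2.
Proof. by move=> ltin; rewrite /low_pair /high_pair; lia_if. Qed.

(** Treated apart because the general formulas for two leaves would give both spine vertices the
    weight 8. *)
Lemma two_valued_labeling_2_2 : has_two_valued_labeling 2 2.
Proof.
exists (fun i => if i == 1 then 1 else 0), (fun i x => 2 + 2 * i + x).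
exists (fun b => if b then 10 else 6); split=> //=.
- by split; lia_if.
- by move=> [|[|i]] // _; rewrite !big_ord_recr big_ord0.
Qed.

Lemma two_valued_labeling_leaf2 n : 2 < n -> has_two_valued_labeling n 2.
Proof.
move=> n_gt2; pose l := n.-1./2.
(* Labels descend from [n - 1] at odd indices and ascend at even ones, so before the last vertex the
   consecutive sums alternate between [n - 1] and [n]. *)
pose e i := if i == n then 0 else if odd i then n - 1 - i./2 else i./2.
exists e, (add_pair n 0 (fun _ _ => 0) (low_pair n) (high_pair n)).
exists (fun b : bool =>
  n - 1 + b + 2 * n + l + (if b == odd n.-1 then n else 2 * n - 1)).
split.
- apply: add_pair_labeling; last by apply: low_high_pairing; lia.
  by rewrite /e; split; lia_if.
- by rewrite /e; lia_if.
- by rewrite /=; case: (odd n.-1) => /=; lia_if.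
- move=> i ltin; rewrite sum_add_pair big_ord0.
  by rewrite -(addnA _ (low_pair n i)) low_high_sum // /e /l; lia_if.
Qed.

Lemma two_valued_labeling_leaf3_even n h :
  0 < h -> n = 2 * h -> has_two_valued_labeling n 3.
Proof.
move=> h_gt0 nE.
(* Before the last vertex the consecutive sums are [h + i]; the first leaf label [2 * n - 1 - i]
   cancels the growth, and the pairs alone separate the parities. *)
pose e i := if i == n then 0 else if odd i then h + i./2 else i./2.
pose p (i x : nat) := 2 * n - 1 - i.
exists e, (add_pair n 1 p (low_pair n) (high_pair n)).
exists (fun b : bool =>
  h + 2 * n - 1 + 4 * n + h.-1 + (if b then n else 2 * n - 1)).
split.
- apply: add_pair_labeling; last by apply: low_high_pairing; lia.
  by rewrite /e /p; split; lia_if.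
- by rewrite /e; lia_if.
- by lia_if.
- move=> i ltin; rewrite sum_add_pair big_ord1.
  by rewrite -(addnA _ (low_pair n i)) low_high_sum // /e /p; lia_if.
Qed.

Lemma two_valued_labeling_leaf3_odd n h :
  0 < h -> n = 2 * h + 1 -> has_two_valued_labeling n 3.
Proof.
move=> h_gt0 nE.
pose e i := if i == n then 0 else if odd i then h.+1 + i./2 else i./2.
(* The label [2 * n - 1] at the last vertex exactly makes up for [e n = 0]: spine and first leaf
   labels sum to [h + 2 * n - 1] everywhere, so the pairs need no exception there. *)
pose p (i x : nat) := if i == 2 * h then 2 * n - 1 else 2 * n - 2 - i.
pose a i := if odd i then h + 1 + i./2 else i./2.
pose b i := if odd i then 4 * h + 1 - i./2 else 3 * h + 1 - i./2.
exists e, (add_pair n 1 p a b).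
exists (fun b : bool =>
  h + 2 * n - 1 + 4 * n + (if b then 5 * h + 2 else 3 * h + 1)).
split.
- apply: add_pair_labeling; first by rewrite /e /p; split; lia_if.
  by rewrite /a /b; split; lia_if.
- by rewrite /e; lia_if.
- by lia_if.
- by move=> i ltin; rewrite sum_add_pair big_ord1 /e /p /a /b; lia_if.
Qed.

Lemma two_valued_labeling_ex n m :
  1 < n -> 1 < m -> has_two_valued_labeling n m.
Proof.
move=> n_gt1 m_gt1.
have l2 : has_two_valued_labeling n 2.
  have [->|n_gt2] : n = 2 \/ 2 < n by lia.
    exact: two_valued_labeling_2_2.
  exact: two_valued_labeling_leaf2.
have l3 : has_two_valued_labeling n 3.
  have h_gt0 : 0 < n./2 by lia.
  have [|] : n = 2 * n./2 \/ n = 2 * n./2 + 1 by lia.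
    exact: two_valued_labeling_leaf3_even.
  exact: two_valued_labeling_leaf3_odd.
case: m m_gt1 => [|[|m]] // _.
suff [] : has_two_valued_labeling n m.+2 /\
  has_two_valued_labeling n m.+3 by [].
by elim: m => [|m [IH1 IH2]]; split=> //; apply: has_two_valued_labelingSS.
Qed.

(** * Counting and summing distinct positive integers *)

Lemma inj_surj_interval (T : finType) (g : T -> nat) k :
  injective g -> (forall t, 0 < g t <= #|T|) -> 0 < k <= #|T| ->
  exists t, g t = k.
Proof.
move=> g_inj gR kR.
have g_uniq : uniq (codom g) by apply/injectiveP.
have sub : {subset codom g <= iota 1 #|T|}.
  by move=> _ /codomP[t ->]; rewrite mem_iota; have := gR t; lia.
have sz : size (iota 1 #|T|) <= size (codom g) by rewrite size_iota size_codom.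
have [_ eqi] := uniq_min_size g_uniq sub sz.
have /codomP[t ->] : k \in codom g by rewrite eqi mem_iota; lia.
by exists t.
Qed.

(** Induction on [#|D|]: the values cannot all lie in 1, .., [#|D| - 1], so some element has value
    at least [#|D|], and it is removed. *)
Lemma leq_sum_inj (T : finType) (g : T -> nat) (D : {set T}) :
  injective g -> (forall t, 0 < g t) ->
  #|D| * #|D|.+1 <= 2 * \sum_(t in D) g t.
Proof.
move=> g_inj g_gt0; move: {2}#|D| (erefl #|D|) => s.
elim: s D => [|s IH] D; first by move=> ->.
move=> Ds.
have [t tD gt] : exists2 t, t \in D & #|D| <= g t.
  apply/exists_inP; apply: contraT; rewrite negb_exists_in => /forall_inP small.
  have : size [seq g t | t in D] <= size (iota 1 s).
    apply: uniq_leq_size; first by rewrite map_inj_uniq ?enum_uniq.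
    move=> _ /mapP[t + ->]; rewrite mem_enum mem_iota g_gt0 /= => tD.
    by have := small t tD; rewrite Ds; lia.
  by rewrite size_map size_iota -cardE Ds ltnn.
have Dt : #|D :\ t| = s by have := cardsD1 t D; rewrite tD Ds; lia.
have := IH _ Dt; rewrite (big_setD1 t tD) /= Ds Dt; rewrite Ds in gt.
by move: (\sum_(_ in _) _) => r; lia.
Qed.

(** * Edges and vertex weights of the corona *)

Section Caterpillar.
Variables N m : nat.
Let G := corona (path_graph N.+1) (null_graph m).
Let T := ('I_N + 'I_N.+1 * 'I_m)%type.

Definition edge_of (t : T) : {set G} :=
  match t with
  | inl k => [set (inl (inord k) : G); inl (inord k.+1)]
  | inr p => [set (inl p.1 : G); inr p]
  end.

Lemma inl_in_edge (i : 'I_N.+1) (t : T) : ((inl i : G) \in edge_of t) =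
  match t with inl k => (i == k :> nat) || (i == k.+1 :> nat)
             | inr p => i == p.1 end.
Proof.
case: t => [k|p] /=; rewrite !inE; last by rewrite orbF.
have inlE (a b : 'I_N.+1) : ((inl a : G) == inl b) = (a == b) by [].
by rewrite !inlE -!val_eqE /= !inordK //; case: k => k /=; lia.
Qed.

Lemma inr_in_edge (p : 'I_N.+1 * 'I_m) (t : T) :
  ((inr p : G) \in edge_of t) = (t == inr p).
Proof. by case: t => [k|r] /=; rewrite !inE //= eq_sym. Qed.

Lemma edge_of_inj : injective edge_of.
Proof.
move=> t u tu.
case: u tu => [k|p] tu; last first.
  by apply/eqP; rewrite -inr_in_edge tu inr_in_edge.
case: t tu => [l|p] tu; last first.
  by apply/esym/eqP; rewrite -inr_in_edge -tu inr_in_edge.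
have kl (i : 'I_N.+1) := inl_in_edge i (inl k).
have ll (i : 'I_N.+1) := inl_in_edge i (inl l).
congr inl; apply: val_inj => /=.
have [k1 l1] : k < N.+1 /\ l < N.+1 by case: (k) (l) => ? ? [? ?] /=; lia.
have [k2 l2] : k.+1 < N.+1 /\ l.+1 < N.+1 by case: (k) (l) => ? ? [? ?] /=; lia.
(* Both [l] and [l + 1] must lie in {k, k + 1}, which leaves only [l = k]. *)
move: (kl (Ordinal l1)) (kl (Ordinal l2)); rewrite -!tu !ll /=; lia.
Qed.

Lemma edges_corona : edges G = edge_of @: setT.
Proof.
apply/setP=> A; apply/imsetP/imsetP => [[[a b] + ->]|[t _ ->]].
  rewrite inE /=; case: a b => [i|p] [j|r] //=.
  - move=> /orP[] /eqP ij.
      have iN : i < N by case: (i) (j) ij => ? ? [? ?] /=; lia.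
      by exists (inl (Ordinal iN)) => //=; rewrite ij !inord_val.
    have iN : j < N by case: (j) (i) ij => ? ? [? ?] /=; lia.
    by exists (inl (Ordinal iN)) => //=; rewrite ij !inord_val setUC.
  - by move=> /eqP ->; exists (inr r).
  - by move=> /eqP ->; exists (inr p) => //=; rewrite setUC.
  - by rewrite andbF.
case: t => [k|p] /=.
  exists (inl (inord k) : G, inl (inord k.+1) : G) => //=.
  by rewrite inE /= /path_rel !inordK ?eqxx //; case: k => k /=; lia.
by exists (inl p.1 : G, inr p : G) => //=; rewrite inE /=.
Qed.

Lemma card_edges : #|edges G| = N.+1 * m + N.
Proof.
rewrite edges_corona card_imset; last exact: edge_of_inj.
by rewrite cardsT card_sum card_prod !card_ord addnC.
Qed.

Lemma weight_corona f (u : G) :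
  weight f u = \sum_(t | u \in edge_of t) f (edge_of t).
Proof.
rewrite /weight edges_corona big_imset_cond /=; last first.
  by move=> t v _ _; apply: edge_of_inj.
by apply: eq_bigl => t; rewrite inE.
Qed.

Lemma weight_leaf f p : weight f (inr p : G) = f (edge_of (inr p)).
Proof.
by rewrite weight_corona (big_pred1 (inr p)) // => t; rewrite inr_in_edge.
Qed.

Lemma weight_spine f (i : 'I_N.+1) : weight f (inl i : G) =
  \sum_(k < N | (i == k :> nat) || (i == k.+1 :> nat)) f (edge_of (inl k)) +
  \sum_(x < m) f (edge_of (inr (i, x))).
Proof.
rewrite weight_corona big_sumType; congr (_ + _).
  by apply: eq_bigl => k; rewrite inl_in_edge.
rewrite (reindex_onto (fun x => (i, x)) snd) => [|[j x]].
  by apply: eq_bigl => x; rewrite inl_in_edge !eqxx.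
by rewrite inl_in_edge => /= /eqP ->.
Qed.

Lemma leaf_label_lt_weight f i x : 0 < N ->
  (forall t, 0 < f (edge_of t)) ->
  f (edge_of (inr (i, x))) < weight f (inl i : G).
Proof.
move=> N_gt0 f_gt0; rewrite weight_spine (bigD1 x) //= addnCA.
rewrite -[ltnLHS]addn0 ltn_add2l addn_gt0; apply/orP; left.
(* The spine edge to the left of [i]; for [i = 0] the truncated predecessor selects the edge to its
   right. *)
have kN : i.-1 < N by have := ltn_ord i; lia.
rewrite (bigD1 (Ordinal kN)) /=; last by lia.
exact: ltn_addr (f_gt0 (inl (Ordinal kN))).
Qed.

Lemma spine_sumE (e : nat -> nat) i : e 0 = 0 -> e N.+1 = 0 -> i < N.+1 ->
  \sum_(k < N | (i == k :> nat) || (i == k.+1 :> nat)) e k.+1 = e i + e i.+1.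
Proof.
move=> e0 eN ltiN.
(* The edge to the left of [i] is split off; at either end of the path a zero of [e] stands for the
   missing edge. *)
rewrite (bigID (fun k : 'I_N => i == k.+1 :> nat)) /=; congr (_ + _).
  case: i ltiN => [|i] ltiN.
    by rewrite e0 big_pred0 // => k; rewrite andbC.
  rewrite (big_pred1 (Ordinal (ltiN : i < N))) // => k.
  by rewrite /= -val_eqE /=; lia.
have [iN|iN] := ltnP i N.
  rewrite (big_pred1 (Ordinal iN)) // => k.
  by rewrite /= -val_eqE /=; lia.
have -> : i = N by lia.
by rewrite eN big_pred0 // => k; case: k => k /=; lia.
Qed.

(** * Lower bound *)

(* Each edge meeting [B] is counted in at least one of the weights on the
   left, and independence of the complement makes every spine edge such. *)
Lemma light_spine_card f (B : {set 'I_N.+1}) :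
  (forall i j : 'I_N.+1, path_rel i j -> (i \in B) || (j \in B)) ->
  injective (f \o edge_of) -> (forall t, 0 < f (edge_of t)) ->
  (m * #|B| + N) * (m * #|B| + N).+1 <=
  2 * \sum_(i in B) weight f (inl i : G).
Proof.
move=> cover f_inj f_gt0.
pose D : {set T} :=
  [set t | match t with inl _ => true | inr p => p.1 \in B end].
have cardD : #|D| = m * #|B| + N.
  rewrite -sum1_card big_sumType /= (eq_bigl xpredT) => [|k].
    2: by rewrite inE.
  rewrite sum1_card card_ord addnC; congr (_ + _).
  rewrite (eq_bigl (fun p => (p.1 \in B) && true)) => [|p].
    2: by rewrite inE andbT.
  rewrite -(pair_big (mem B) xpredT (fun _ _ => 1)) /=.
  by under eq_bigr do rewrite sum1_card card_ord; rewrite sum_nat_const mulnC.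
rewrite -cardD (leq_trans (leq_sum_inj D f_inj f_gt0)) // leq_mul2l /=.
under [leqRHS]eq_bigr do rewrite weight_corona.
rewrite (exchange_big_dep xpredT) //= big_mkcond /=.
apply: leq_sum => t _; case: ifP => // tD.
have [i iB it] : exists2 i, i \in B & (inl i : G) \in edge_of t.
  case: t tD => [k|p]; rewrite inE => tD.
    2: by exists p.1 => //; rewrite inl_in_edge.
  have kN := ltn_ord k.
  have /cover/orP[] : @path_rel N.+1 (inord k) (inord k.+1).
    by rewrite /path_rel !inordK ?eqxx //; lia.
  - by exists (inord k) => //; rewrite inl_in_edge inordK ?eqxx //; lia.
  - by exists (inord k.+1) => //; rewrite inl_in_edge inordK ?eqxx ?orbT.
by rewrite (bigD1 i) ?iB //= leq_addr.
Qed.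

(** After cancelling [2 * m * b * N], the squares of [m * b] and [N] remain on the right. Their sum
    is at least [2 * m * b * N], which covers [m * b + 2 * b * N]; [N > 0] gives strictness. *)
Lemma quadratic_gap b : 0 < N -> 1 < m ->
  2 * (b * (N.+1 * m + N)) < (m * b + N) * (m * b + N).+1.
Proof.
move=> N_gt0 m_gt1.
have := (nat_Cauchy (m * b) N).1.
have : 2 * b * N <= m * b * N by rewrite !leq_mul2r m_gt1 !orbT.
have : m * b <= m * b * N by rewrite leq_pmulr.
by rewrite -!mulnn; nia.
Qed.

Lemma chi_la_lower f : 0 < N -> 1 < m -> @local_antimagic G f ->
  m * N.+1 + 2 <= num_colors f.
Proof.
move=> N_gt0 m_gt1 [f_inj f_onto f_adj].
set q := N.+1 * m + N.
have edgeE t : edge_of t \in edges G by rewrite edges_corona imset_f.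
have fR t : 0 < f (edge_of t) <= q.
  by rewrite /q -card_edges; apply/f_onto; exists (edge_of t).
have g_inj : injective (f \o edge_of).
  by move=> t u /= /f_inj tu; apply: edge_of_inj; apply: tu.
pose B := [set i : 'I_N.+1 | weight f (inl i : G) <= q].
have /existsP[i /existsP[j /and3P[ij iB jB]]] : [exists i : 'I_N.+1,
    [exists j : 'I_N.+1, [&& path_rel i j, i \notin B & j \notin B]]].
  (* Otherwise [B] covers every spine edge, while its total weight is at most [#|B| * q]. *)
  apply: contraT => /existsPn nB.
  suff : (m * #|B| + N) * (m * #|B| + N).+1 <= 2 * (#|B| * q).
    by have := quadratic_gap #|B| N_gt0 m_gt1; rewrite -/q; lia.
  apply: leq_trans (light_spine_card _ g_inj _) _ => [i j ij|t|].
  - have /existsPn/(_ j) := nB i.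
    by rewrite ij /= negb_and !negbK.
  - by have /andP[] := fR t.
  - rewrite leq_mul2l /= -sum_nat_const; apply: leq_sum => i.
    by rewrite inE.
pose s := [:: weight f (inl i : G), weight f (inl j : G) &
           [seq f (edge_of (inr p)) | p : 'I_N.+1 * 'I_m]].
have -> : m * N.+1 + 2 = size s.
  by rewrite /= size_map -cardE card_prod !card_ord mulnC addn2.
apply: uniq_leq_size.
  have heavy k : k \notin B -> weight f (inl k : G) \notin
      [seq f (edge_of (inr p)) | p : 'I_N.+1 * 'I_m].
    rewrite inE -ltnNge => q_lt; apply/mapP => -[p _ wE].
    by have /andP[_] := fR (inr p); rewrite -wE leqNgt q_lt.
  rewrite /s /= inE negb_or (heavy i iB) (heavy j jB) !andbT.
  apply/andP; split; first by apply/eqP; apply: f_adj.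
  rewrite map_inj_uniq ?enum_uniq // => p r /(g_inj (inr p) (inr r)).
  by case.
move=> c; rewrite mem_undup !inE => /or3P[/eqP->|/eqP->|/mapP[p _ ->]].
- by apply: map_f; rewrite mem_enum.
- by apply: map_f; rewrite mem_enum.
by rewrite -weight_leaf; apply: map_f; rewrite mem_enum.
Qed.

(** * Upper bound *)

Definition edge_label (e : nat -> nat) (p : nat -> nat -> nat) (t : T) : nat :=
  match t with inl k => e k.+1 | inr r => p r.1 r.2 end.

(** Transports labels along the inverse of [edge_of]; the default 0 is met only on sets that are not
    edges. *)
Definition corona_label e p (A : {set G}) : nat :=
  if [pick t | edge_of t == A] is Some t then edge_label e p t else 0.

Lemma corona_labelE e p t : corona_label e p (edge_of t) = edge_label e p t.
Proof.
rewrite /corona_label; case: pickP => [u /eqP /edge_of_inj -> //|/(_ t)].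
by rewrite eqxx.
Qed.

Lemma edge_label_inj e p : labeling N.+1 m e p -> injective (edge_label e p).
Proof.
move=> [_ _ eI pI dep].
have kR (k : 'I_N) : 0 < k.+1 < N.+1 by have := ltn_ord k; lia.
move=> [k|[i x]] [l|[j y]] /=.
- by move/(eI _ _ (kR k) (kR l)) => -[kl]; congr inl; apply: val_inj.
- by move/(dep _ _ _ (kR k) (ltn_ord j) (ltn_ord y)).
- by move/esym/(dep _ _ _ (kR l) (ltn_ord i) (ltn_ord x)).
- move/(pI _ _ _ _ (ltn_ord i) (ltn_ord x) (ltn_ord j) (ltn_ord y)) => -[ij xy].
  by congr (inr (_, _)); apply: val_inj.
Qed.

Lemma chi_la_upper : 0 < N -> has_two_valued_labeling N.+1 m ->
  exists2 f, @local_antimagic G f & num_colors f <= m * N.+1 + 2.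
Proof.
move=> N_gt0 [e [p [w [lab [e0 eN] w_neq wE]]]].
have g_inj := edge_label_inj lab.
have gR t : 0 < edge_label e p t <= N.+1 * m + N.
  case: t => [k|[i x]] /=; last exact: (leaf_range lab).
  by apply: (spine_range lab); have := ltn_ord k; lia.
have f_gt0 t : 0 < corona_label e p (edge_of t).
  by rewrite corona_labelE; have /andP[] := gR t.
have spineE (i : 'I_N.+1) : weight (corona_label e p) (inl i : G) = w (odd i).
  rewrite weight_spine -wE // -(spine_sumE e0 eN) //.
  by congr (_ + _); apply: eq_bigr => k _; rewrite corona_labelE.
have leafE r : weight (corona_label e p) (inr r : G) = edge_label e p (inr r).
  by rewrite weight_leaf corona_labelE.
have lf (i : 'I_N.+1) r : i == r.1 ->
    weight (corona_label e p) (inr r : G) <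
    weight (corona_label e p) (inl i : G).
  case: r => j x /= /eqP <-; rewrite weight_leaf; exact: leaf_label_lt_weight.
exists (corona_label e p).
  split.
  - rewrite edges_corona => _ _ /imsetP[t _ ->] /imsetP[u _ ->].
    by rewrite !corona_labelE => /g_inj ->.
  - move=> k; rewrite card_edges edges_corona.
    split=> [kR|[_ /imsetP[t _ ->] <-]].
      have cT : #|{: 'I_N + 'I_N.+1 * 'I_m}| = N.+1 * m + N.
        by rewrite card_sum card_prod !card_ord addnC.
      have [t tk] : exists t, edge_label e p t = k.
        by apply: inj_surj_interval g_inj _ _; rewrite cT.
      by exists (edge_of t); rewrite ?imset_f ?corona_labelE.
    by rewrite corona_labelE.
  - case=> [i|r] [j|s] //=; last by rewrite andbF.
    + rewrite !spineE => ij wij.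
      have : odd i = ~~ odd j by case/orP: ij => /eqP <-; rewrite /= ?negbK.
      by move: wij => + oij; rewrite oij; case: (odd j) => /= ?; apply: w_neq.
    + by move=> ij eq_w; have := lf _ _ ij; rewrite eq_w ltnn.
    + by move=> ij eq_w; have := lf _ _ ij; rewrite -eq_w ltnn.
(* A spine weight could a priori equal a leaf label, so this list only bounds the number of colors
   from above. *)
pose s := [:: w true, w false &
  [seq edge_label e p (inr r) | r : 'I_N.+1 * 'I_m]].
have -> : m * N.+1 + 2 = size s.
  by rewrite /= size_map -cardE card_prod !card_ord mulnC addn2.
apply: uniq_leq_size; first exact: undup_uniq.
move=> c; rewrite mem_undup => /mapP[[i|r] _ ->].
  by rewrite spineE !inE; case: (odd i); rewrite eqxx ?orbT.
by rewrite leafE !inE; apply/or3P/Or33/mapP; exists r; rewrite ?mem_enum.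
Qed.

End Caterpillar.

Theorem theorem2p6 (m n : nat) (hm : 2 <= m) (hn : 2 <= n) :
  is_chi_la (corona (path_graph n) (null_graph m)) (m * n + 2).
Proof.
have [N nE] : exists N, n = N.+1 by exists n.-1; lia.
rewrite nE in hn *; have N_gt0 : 0 < N by [].
have lower f := @chi_la_lower N m f N_gt0 hm.
split=> //.
have [f f_la f_le] := chi_la_upper N_gt0 (two_valued_labeling_ex hn hm).
by exists f => //; apply/eqP; rewrite eqn_leq f_le lower.
Qed.
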